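(* Let $n \ge 1$, let $p_k$ denote the $k$th prime ($p_1 = 2$, $p_2 = 3$, \dots), and for each $k \in [n]$ let $S_k = [p_{k+1}] = \{1,\dots,p_{k+1}\}$. Let $Q = S_1 \times \cdots \times S_n$. Then any collection of hyperplanes in $Q$ (each with a non-empty set of fixed coordinates) whose union is $Q$ contains two distinct parallel hyperplanes.
   Context: For finite sets $S_1,\dots,S_n$, a hyperplane in $Q = S_1\times\cdots\times S_n$ is a set $A = A_1\times\cdots\times A_n$ where each $A_k$ is either $S_k$ or a singleton subset of $S_k$. Its set of fixed coordinates is $F(A) = \{k : A_k \ne S_k\}$ (i.e. $A_k$ is a singleton). Two hyperplanes $A, A'$ are parallel if $F(A) = F(A')$. *)

(* Defs.v *)
From mathcomp Require Import all_boot.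
Set Implicit Arguments. Unset Strict Implicit. Unset Printing Implicit Defensive.

(* Primes, 0-indexed: kth_prime 0 = 2, kth_prime 1 = 3, ...
   (the paper's p_k is kth_prime k.-1). *)
Definition next_prime (p : nat) : nat :=
  ex_minn (let: exist2 q Hpq Hq := prime_above p in
           ex_intro (fun q => (p < q) && prime q) q (introT andP (conj Hpq Hq))).

Fixpoint kth_prime (k : nat) : nat :=
  if k is k'.+1 then next_prime (kth_prime k') else 2.

(* Coordinate k : 'I_n (0-based, i.e. the paper's coordinate k+1) has
   S = [p_{(k+1)+1}] = {1..p_{k+2}}, encoded as 'I_(kth_prime k.+1). *)
Definition side (k : nat) : nat := kth_prime k.+1.

Definition point (n : nat) := {dffun forall k : 'I_n, 'I_(side k)}.

(* A hyperplane A_1 x ... x A_n is encoded by its coordinate choices: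
   None means A_k = S_k, Some a means A_k = {a}. *)
Definition hyperplane (n : nat) := {dffun forall k : 'I_n, option 'I_(side k)}.

Definition in_hyperplane n (A : hyperplane n) (x : point n) : bool :=
  [forall k, if A k is Some a then x k == a else true].

Definition fixed n (A : hyperplane n) : {set 'I_n} :=
  [set k | A k != None].

Definition parallel n (A B : hyperplane n) : bool := fixed A == fixed B.

(* Main.v *)
Require Import Defs.
From Stdlib Require Import NArith.
From mathcomp Require Import all_boot all_order all_algebra zify ring lra.
Set Implicit Arguments. Unset Strict Implicit. Unset Printing Implicit Defensive.
Import Order.TTheory GRing.Theory Num.Theory.

(** The distortion method.  Suppose that no two hyperplanes are parallel.  Put
a weight on the uncovered points, one coordinate at a time: if [b] of the [p]
points above a prefix get covered by the hyperplanes whose last fixed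
coordinate is the new one, the weight of the prefix is shared equally among
the other [p - b], each receiving at most a proportion [1 / (p - t)], where
[t] is about [p / 4].  Weight is lost only when [b > t], in proportion
[(b - t) / (p - t)].

Since [b] is at most the number [N] of those hyperplanes that agree with the
prefix, it suffices to bound the mean of [max (N - t, 0)].  For convex
functions of [N] the worst case is that of hyperplanes through a common point:
[N] is then [2] to the power of the number of coordinates agreeing with that
point, and these agreements are independent of probability [1 / (p_j - t_j)].
With this explicit law the total loss is about 0.53 for the primes below 4001,
which is obtained by computation.  For the later primes one uses
[max (N - t, 0) <= N^2 / (4 t)] and the fact that at most 480 of any 2310
consecutive integers are primes; these primes lose less than 0.37. *)

(** * Weights on the uncovered points *)

Section Distortion.
Local Open Scope ring_scope.

Variables (R : realFieldType) (p t : nat -> nat).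
Hypothesis tp : forall k, (t k < p k)%N.

Definition xi k : R := ((p k - t k)%N%:R)^-1.

Lemma xi_ge0 k : 0 <= xi k.
Proof. by rewrite invr_ge0 ler0n. Qed.

Lemma xi_le1 k : xi k <= 1.
Proof. by rewrite invf_le1 ?ltr0n ?ler1n subn_gt0. Qed.

(** Mean of [phi (2 ^ X)], where [X] counts the successes in independent trials [j < k] of
    probability [xi j]. *)
Fixpoint expect k (phi : nat -> R) : R :=
  if k is k'.+1 then
    (1 - xi k') * expect k' phi + xi k' * expect k' (fun m => phi m.*2)
  else phi 1%N.

Lemma expect_le k c phi psi :
  (forall m, phi m <= c * psi m) -> expect k phi <= c * expect k psi.
Proof.
elim: k phi psi => [|k IH] phi psi le_phi //=.
have := xi_ge0 k; have := xi_le1 k => x1 x0.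
rewrite mulrDr (mulrCA c) (mulrCA c (xi k)).
by rewrite lerD // ler_wpM2l ?subr_ge0 // IH // => m; apply: le_phi.
Qed.

Lemma expect_ge0 k phi : (forall m, 0 <= phi m) -> 0 <= expect k phi.
Proof.
elim: k phi => [|k IH] phi phi0 //=.
by rewrite addr_ge0 // mulr_ge0 ?subr_ge0 ?xi_ge0 ?xi_le1 ?IH.
Qed.

Lemma eq_expect k phi psi : phi =1 psi -> expect k phi = expect k psi.
Proof.
elim: k phi psi => [|k IH] phi psi eq_phi //=.
by congr (_ * _ + _ * _); apply: IH => m.
Qed.

(** Prefixes are stored with the newest coordinate first, so that extending one is a cons;
    coordinate [j] of [x] is therefore [nth 0 (rev x) j]. *)
Fixpoint sum_box k (F : seq nat -> R) : R :=
  if k is k'.+1 then sum_box k' (fun x => \sum_(y < p k') F (nat_of_ord y :: x))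
  else F [::].

Lemma sum_box_le k F G :
  (forall x, size x = k -> F x <= G x) -> sum_box k F <= sum_box k G.
Proof.
elim: k F G => [|k IH] F G le_FG /=; first exact: le_FG.
by apply: IH => x sx; apply: ler_sum => y _; apply: le_FG; rewrite /= sx.
Qed.

Lemma sum_boxDM k a b F G :
  sum_box k (fun x => a * F x + b * G x) = a * sum_box k F + b * sum_box k G.
Proof.
elim: k F G => [|k IH] F G //=; rewrite -IH.
have eq_sum H H' : H =1 H' -> sum_box k H = sum_box k H'.
  by move=> eH; apply/le_anti/andP; split; apply: sum_box_le => x _; rewrite eH.
by apply: eq_sum => x; rewrite big_split -!mulr_sumr.
Qed.

Lemma sum_box_gt0 k F : 0 < sum_box k F ->
  exists2 x, size x = k & all (fun j => nth 0 (rev x) j < p j)%N (iota 0 k) /\ 0 < F x.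
Proof.
elim: k F => [|k IH] F; first by exists [::].
rewrite [sum_box _ _]/= => /IH[x sx [xp]].
have [y Fy|none] := boolP [exists y : 'I_(p k), 0 < F (nat_of_ord y :: x)].
  case/existsP: y Fy => y Fy _; exists (nat_of_ord y :: x); first by rewrite /= sx.
  split=> //; rewrite -(addn1 k) iotaD all_cat /= andbT add0n.
  rewrite rev_cons nth_rcons size_rev sx ltnn eqxx ltn_ord andbT.
  apply/allP => j; rewrite mem_iota add0n => /andP[_ jk].
  by rewrite nth_rcons size_rev sx jk (allP xp) // mem_iota.
rewrite ltNge sumr_le0 // => y _.
by move/existsPn: none => /(_ y); rewrite -leNgt.
Qed.

(* [hypsum k r f]: [f] is dominated by a sum of indicators of hyperplanes of
   the first [k] coordinates in which every set of fixed coordinates occurs at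
   most [r] times.  [U] collects those that do not fix the last coordinate,
   and [V] those that do, with that coordinate forgotten. *)
Fixpoint hypsum k (r : nat) (f : seq nat -> nat) : Prop :=
  if k is k'.+1 then
    exists U V, [/\ hypsum k' r U, hypsum k' r V &
      forall x, size x = k' -> exists2 v : nat -> nat,
        (\sum_(y < p k') v y <= V x)%N &
        forall y, (y < p k')%N -> (f (y :: x) <= U x + v y)%N]
  else (f [::] <= r)%N.

Lemma hypsumD k r s f g :
  hypsum k r f -> hypsum k s g -> hypsum k (r + s) (fun x => f x + g x)%N.
Proof.
elim: k r s f g => [|k IH] r s f g /=; first exact: leq_add.
move=> [U [V [hU hV hf]]] [U' [V' [hU' hV' hg]]].
exists (fun x => U x + U' x)%N, (fun x => V x + V' x)%N; split; try exact: IH.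
move=> x sx; have [v sv fv] := hf x sx; have [v' sv' gv'] := hg x sx.
exists (fun y => v y + v' y)%N; first by rewrite big_split leq_add.
by move=> y yp; rewrite addnACA leq_add ?fv ?gv'.
Qed.

Variable W : seq nat -> R.
Hypothesis W0 : W [::] = 1.
Hypothesis W_ge0 : forall x, 0 <= W x.
Hypothesis W_sum : forall x, \sum_(y < p (size x)) W (nat_of_ord y :: x) <= W x.
Hypothesis W_le : forall x y, W (y :: x) <= xi (size x) * W x.

Definition convex_nat (phi : nat -> nat) :=
  {homo phi : a b / (a <= b)%N >-> (a <= b)%N} /\
  forall u a b, (phi (u + a) + phi (u + b) <= phi u + phi (u + a + b))%N.

(** Increments of a convex function are superadditive, so concentrating all of [v] on a single point
    is the worst case. *)
Lemma convex_nat_sum phi (I : eqType) (s : seq I) u (v : I -> nat) :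
  convex_nat phi ->
  (\sum_(y <- s) (phi (u + v y) - phi u) <= phi (u + \sum_(y <- s) v y) - phi u)%N.
Proof.
move=> [mono conv]; elim: s => [|y s IH]; first by rewrite !big_nil.
rewrite !big_cons.
have := conv u (v y) (\sum_(y <- s) v y)%N; rewrite -addnA.
have := mono u (u + v y)%N (leq_addr _ _).
have := mono u (u + \sum_(y <- s) v y)%N (leq_addr _ _).
by move: IH; lia.
Qed.

Lemma weighted_convex phi k (u V : nat) (v : nat -> nat) x : size x = k ->
  convex_nat phi -> (\sum_(y < p k) v y <= V)%N ->
  \sum_(y < p k) W (nat_of_ord y :: x) * (phi (u + v y))%:R <=
  (1 - xi k) * (W x * (phi u)%:R) + xi k * (W x * (phi (u + V))%:R).
Proof.
move=> <-{k} cphi; set k := size x => sv; have [mono conv] := cphi.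
have -> : \sum_(y < p k) W (nat_of_ord y :: x) * (phi (u + v y))%:R =
   (\sum_(y < p k) W (nat_of_ord y :: x)) * (phi u)%:R +
   \sum_(y < p k) W (nat_of_ord y :: x) * (phi (u + v y) - phi u)%N%:R.
  rewrite mulr_suml -big_split; apply: eq_bigr => y _ /=.
  by rewrite -mulrDr -natrD subnKC // mono // leq_addr.
have le1 : (\sum_(y < p k) W (nat_of_ord y :: x)) * (phi u)%:R <= W x * (phi u)%:R.
  by rewrite ler_wpM2r ?ler0n ?W_sum.
have le2 : \sum_(y < p k) W (nat_of_ord y :: x) * (phi (u + v y) - phi u)%N%:R <=
   xi k * W x * (phi (u + V) - phi u)%N%:R.
  apply: (@le_trans _ _ (\sum_(y < p k) xi k * W x * (phi (u + v y) - phi u)%N%:R)).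
    by apply: ler_sum => y _; rewrite ler_wpM2r ?ler0n ?W_le.
  rewrite -mulr_sumr ler_wpM2l ?mulr_ge0 ?xi_ge0 // -natr_sum ler_nat.
  apply: leq_trans (convex_nat_sum _ _ _ cphi) _.
  by rewrite leq_sub2r // mono // leq_add2l.
apply: (le_trans (lerD le1 le2)).
rewrite natrB ?mono ?leq_addr //.
by rewrite le_eqVlt; apply/orP; left; apply/eqP; ring.
Qed.

(* The extremal family is the one where all hyperplanes pass through a common
   point and the coordinates agree with that point independently, coordinate
   [k] with probability [xi k]: then [f] is [r] times [2] to the power of the
   number of agreements. *)
Lemma hypsum_expect k r f phi : convex_nat phi -> hypsum k r f ->
  sum_box k (fun x => W x * (phi (f x))%:R) <= expect k (fun m => (phi (m * r)%N)%:R).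
Proof.
move=> cphi; elim: k r f => [|k IH] r f /=.
  by move=> fr; rewrite W0 mul1r mul1n ler_nat; case: cphi => mono _; apply: mono.
move=> [U [V [hU hV hf]]].
apply: (@le_trans _ _ (sum_box k (fun x => (1 - xi k) * (W x * (phi (U x))%:R) +
   xi k * (W x * (phi (U x + V x)%N)%:R)))).
  apply: sum_box_le => x sx; have [v sv fv] := hf x sx.
  apply: le_trans (weighted_convex (U x) sx cphi sv).
  apply: ler_sum => y _; rewrite ler_wpM2l // ler_nat.
  by case: cphi => mono _; rewrite mono // fv.
rewrite sum_boxDM lerD // ler_wpM2l ?xi_ge0 ?subr_ge0 ?xi_le1 //; first exact: IH.
(* After an agreement [U] and [V] act together: the multiplicity becomes [r + r], which is the
   doubling in [expect]. *)
apply: le_trans (IH _ _ (hypsumD hU hV)) _.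
rewrite le_eqVlt; apply/orP; left; apply/eqP; apply: eq_expect => m.
by congr (phi _)%:R; rewrite addnn -!muln2 -!mulnA (mulnC r).
Qed.

End Distortion.

(** * Sharing the weight and accounting for its loss *)

Section Uncovered.
Local Open Scope ring_scope.

Variables (R : realFieldType) (p t : nat -> nat).
Hypothesis tp : forall k, (t k < p k)%N.

Variable B : seq nat -> nat -> bool.
Variable N : nat -> seq nat -> nat.
Hypothesis hypsumN : forall k, hypsum p k 1 (N k).

Definition bad x := (\sum_(y < p (size x)) B x y)%N.
Hypothesis bad_le : forall x, (bad x <= N (size x) x)%N.

(* [p - minn bad t] is the larger of [p - bad] and [p - t]. *)
Fixpoint weight x : R :=
  if x is y :: x' then
    weight x' * (~~ B x' y)%:R / (p (size x') - minn (bad x') (t (size x')))%N%:R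
  else 1.

Lemma weight_ge0 x : 0 <= weight x.
Proof. by elim: x => //= y x IH; rewrite !mulr_ge0 ?invr_ge0 ?ler0n. Qed.

Lemma weight_le x y : weight (y :: x) <= xi R p t (size x) * weight x.
Proof.
rewrite /= mulrC ler_pM ?invr_ge0 ?ler0n ?mulr_ge0 ?weight_ge0 //.
  by rewrite lef_pV2 ?posrE ?ltr0n ?ler_nat; have := tp (size x); lia.
by rewrite ler_piMr ?weight_ge0 // lern1 leq_b1.
Qed.

(** The shares add up to [(p - b) / (p - min(b, t))]. This is 1 if [b <= t] and
    [1 - (b - t) / (p - t)] otherwise; truncated subtraction unites the cases. *)
Lemma weight_sum x : \sum_(y < p (size x)) weight (nat_of_ord y :: x) =
  weight x - xi R p t (size x) * (weight x * (bad x - t (size x))%N%:R).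
Proof.
set k := size x; have tpk := tp k.
have -> : \sum_(y < p k) weight (nat_of_ord y :: x) =
   weight x / (p k - minn (bad x) (t k))%N%:R * (p k - bad x)%N%:R.
  rewrite /= -/k -mulr_suml -mulr_sumr -natr_sum [RHS]mulrAC; congr (_ * _%:R / _).
  rewrite /bad -/k; apply/esym/eqP; rewrite -(eqn_add2r (\sum_(y < p k) B x y)).
  rewrite subnK -?big_split /=; last first.
    by rewrite -[leqRHS]card_ord -sum1_card leq_sum // => y _; apply: leq_b1.
  by rewrite -[eqbLHS]card_ord -sum1_card; apply/eqP/eq_bigr => y _; case: (B x y).
have d0 : (p k - t k)%N%:R != 0 :> R by rewrite pnatr_eq0; lia.
rewrite /xi; have [le_bt|lt_tb] := leqP (bad x) (t k).
  have -> : (bad x - t k = 0)%N by lia.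
  by rewrite !mulr0 subr0 mulfVK // pnatr_eq0; lia.
have bp : (bad x <= p k)%N.
  by rewrite -[leqRHS]card_ord -sum1_card leq_sum // => y _; apply: leq_b1.
move: d0; rewrite !natrB ?(ltnW lt_tb) ?(ltnW tpk) // => d0; by field.
Qed.

Fixpoint clear x := if x is y :: x' then ~~ B x' y && clear x' else true.

Lemma weight_clear x : 0 < weight x -> clear x.
Proof.
elim: x => //= y x IH; case: (B x y) => /=; first by rewrite mulr0 mul0r ltxx.
rewrite mulr1 => Wx; apply: IH; rewrite lt_neqAle weight_ge0 andbT eq_sym.
by apply: contraTneq Wx => ->; rewrite mul0r ltxx.
Qed.

Definition loss k := xi R p t k * expect p t k (fun m => (m - t k)%N%:R).

Lemma loss_ge0 k : 0 <= loss k.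
Proof.
by rewrite mulr_ge0 ?xi_ge0 ?expect_ge0 // => m; rewrite ler0n.
Qed.

(** By [weight_sum], coordinate [n] costs [xi] times the weighted excess of [bad] over [t n]. The
    excess is convex, so [hypsum_expect] bounds this cost by [loss n]. *)
Lemma mass_ge n : 1 - \sum_(k < n) loss k <= sum_box p n weight.
Proof.
elim: n => [|n IH]; first by rewrite big_ord0 subr0.
rewrite big_ord_recr opprD addrA.
rewrite -[leRHS]/(sum_box p n (fun x => \sum_(y < p n) weight (nat_of_ord y :: x))).
apply: le_trans (_ : sum_box p n (fun x => 1 * weight x +
    (- xi R p t n) * (weight x * (N n x - t n)%N%:R)) <= _); last first.
  apply: sum_box_le => x sx; have := weight_sum x; rewrite sx => ->.
  rewrite mul1r mulNr lerD2l lerN2 ler_wpM2l ?xi_ge0 // ler_wpM2l ?weight_ge0 // ler_nat.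
  by have := bad_le x; rewrite sx; lia.
rewrite sum_boxDM mul1r mulNr lerB // ler_wpM2l ?xi_ge0 //.
have W_sum x : \sum_(y < p (size x)) weight (nat_of_ord y :: x) <= weight x.
  by rewrite weight_sum gerBl !mulr_ge0 ?xi_ge0 ?weight_ge0 ?ler0n.
have cphi : convex_nat (fun m => m - t n)%N.
  by split=> [a b|u a b]; lia.
apply: le_trans (hypsum_expect tp erefl weight_ge0 W_sum weight_le cphi (hypsumN n)) _.
rewrite le_eqVlt; apply/orP; left; apply/eqP/eq_expect => m.
by rewrite muln1.
Qed.

Lemma exists_clear n : \sum_(k < n) loss k < 1 ->
  exists2 x, size x = n & all (fun j => nth 0 (rev x) j < p j)%N (iota 0 n) /\ clear x.
Proof.
move=> lt1; have : 0 < sum_box p n weight.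
  by apply: lt_le_trans (mass_ge n); rewrite subr_gt0.
by case/sum_box_gt0 => x sx [xp Wx]; exists x => //; split=> //; apply: weight_clear.
Qed.

End Uncovered.

(** * Hyperplanes *)

Section Hyperplanes.
Variable n : nat.

(** Reading [None] from [n] on removes the dependent type and lets the recursion run over all
    naturals. *)
Definition coord (A : hyperplane n) (j : nat) : option nat :=
  if insub j is Some i then omap (@nat_of_ord _) (A i) else None.

Lemma coordE A (i : 'I_n) : coord A i = omap (@nat_of_ord _) (A i).
Proof. by rewrite /coord valK. Qed.

Definition agree_at A (x : seq nat) j :=
  if coord A j is Some a then nth 0 (rev x) j == a else true.

Definition agree A k x := all (agree_at A x) (iota 0 k).

Lemma agree_cons A y x :
  agree A (size x).+1 (y :: x) =
  agree A (size x) x && (if coord A (size x) is Some a then y == a else true).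
Proof.
rewrite /agree -addn1 iotaD all_cat /= add0n andbT; congr (_ && _).
  apply: eq_in_all => j; rewrite mem_iota => /andP[_ jx].
  by rewrite /agree_at rev_cons nth_rcons size_rev jx.
by rewrite /agree_at rev_cons nth_rcons size_rev ltnn eqxx.
Qed.

Lemma sum_pred_Some_le (b : bool) (o : option nat) m :
  \sum_(y < m) (b && (o == Some (nat_of_ord y))) <= b.
Proof.
case: b => /=; last by rewrite big1.
case: o => [a|]; last by rewrite big1.
have [am|ma] := ltnP a m; last first.
  rewrite big1 // => y _; case: eqP => // -[ay]; move: ma.
  by rewrite ay leqNgt ltn_ord.
rewrite (bigD1 (Ordinal am)) //= big1 ?addn0 ?leq_b1 // => y ya.
by case: eqP => // -[ay]; case/eqP: ya; apply: val_inj; rewrite /= ay.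
Qed.

(** [M] is a pattern of free coordinates, shared by at most [r] members of [D]. The hyperplanes with
    coordinate [k] free form [U] and those fixing it form [V]; extending a pattern by the status of
    [k] passes the bound [r] to both. *)
Lemma hypsum_agree p k r (D : pred (hyperplane n)) :
  (forall M : nat -> bool,
     \sum_(A | D A) all (fun j => (coord A j == None) == M j) (iota 0 k) <= r) ->
  hypsum p k r (fun x => \sum_(A | D A) agree A k x).
Proof.
elim: k D => [|k IH] D multD /=.
  by apply: leq_trans (multD xpredT); apply/eq_leq/eq_bigr.
pose U x := \sum_(A | D A && (coord A k == None)) agree A k x.
pose V x := \sum_(A | D A && (coord A k != None)) agree A k x.
have mult_restrict b : forall M : nat -> bool,
    \sum_(A | D A && ((coord A k == None) == b))
      all (fun j => (coord A j == None) == M j) (iota 0 k) <= r.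
  move=> M; apply: leq_trans (multD (fun j => if j == k then b else M j)).
  rewrite big_mkcondr; apply: leq_sum => A _; case: eqP => // eb.
  rewrite -addn1 iotaD all_cat /= add0n eqxx eb eqxx !andbT.
  rewrite eq_leq //; congr (nat_of_bool _); apply: eq_in_all => j.
  by rewrite mem_iota => /andP[_ /ltn_eqF->].
exists U, V; split.
- rewrite /U; apply: IH => M; apply: leq_trans (mult_restrict true M).
  by apply/eq_leq/eq_bigl => A; rewrite eqb_id.
- rewrite /V; apply: IH => M; apply: leq_trans (mult_restrict false M).
  by apply/eq_leq/eq_bigl => A; rewrite eqbF_neg.
move=> x sx; exists (fun y => \sum_(A | D A && (coord A k != None))
    (agree A k x && (coord A k == Some y))).
  by rewrite exchange_big; apply: leq_sum => A _; apply: sum_pred_Some_le.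
move=> y _; rewrite (bigID (fun A => coord A k == None)) /= leq_add //.
  by apply: leq_sum => A _; rewrite -sx agree_cons; case: (agree A _ x); rewrite ?leq_b1.
apply: leq_sum => A /andP[_]; rewrite -sx agree_cons; case: (coord A _) => // a _.
by rewrite eq_sym; case: (agree A _ x).
Qed.

Variable C : {set hyperplane n}.
Hypothesis fixed0 : forall A, A \in C -> fixed A != set0.
Hypothesis parallel_inj : forall A A', A \in C -> A' \in C -> parallel A A' -> A = A'.

Definition last_fixed A k :=
  (coord A k != None) && [forall i : 'I_n, (k < i) ==> (A i == None)].

Lemma last_fixed_ex A : A \in C -> exists k : 'I_n, last_fixed A k.
Proof.
move=> /fixed0/set0Pn[i0 Ai0].
case: (@arg_maxnP _ i0 (fun i => i \in fixed A) (@nat_of_ord n) Ai0) => k Ak max_k.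
have cAk : coord A k != None.
  by move: Ak; rewrite coordE inE; case: (A k).
exists k; rewrite /last_fixed cAk; apply/forallP => i; apply/implyP => ki.
by apply: contraLR ki => Ai; rewrite -leqNgt; apply: max_k; rewrite inE.
Qed.

(** Each hyperplane acts at its last fixed coordinate, where membership of a point is finally
    decided. *)
Definition covered x y :=
  [exists A, [&& A \in C, last_fixed A (size x) & agree A (size x).+1 (y :: x)]].

Definition covers k x := \sum_(A | (A \in C) && last_fixed A k) agree A k x.

(** Two hyperplanes counted here with the same pattern below [k] both fix [k] and are both free
    above it, hence are parallel and equal. *)
Lemma hypsum_covers p k : hypsum p k 1 (covers k).
Proof.
apply: hypsum_agree => M; rewrite -big_mkcondr sum1_card.
apply/card_le1_eqP => A A' /andP[/andP[AC lA] mA] /andP[/andP[AC' lA'] mA'].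
apply: parallel_inj => //; apply/eqP/setP => i; rewrite !inE.
have none_coord (D : hyperplane n) : (D i == None) = (coord D i == None).
  by rewrite coordE; case: (D i).
congr (~~ _); case/andP: lA => cA /forallP/(_ i) lA; case/andP: lA' => cA' /forallP/(_ i) lA'.
have [ik|ki|ik] := ltngtP i k.
- rewrite !none_coord; move/allP: mA => /(_ i); move/allP: mA' => /(_ i).
  by rewrite mem_iota add0n ik => /(_ isT)/eqP-> /(_ isT)/eqP->.
- by move: lA lA'; rewrite ki /= => /eqP-> /eqP->.
- by rewrite !none_coord ik (negbTE cA) (negbTE cA').
Qed.

Lemma covered_le p x : \sum_(y < p (size x)) covered x y <= covers (size x) x.
Proof.
set k := size x.
apply: (@leq_trans (\sum_(y < p k) \sum_(A | (A \in C) && last_fixed A k)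
    (agree A k x && (coord A k == Some (nat_of_ord y))))).
  apply: leq_sum => y _; rewrite /covered; case: existsP => // -[A /and3P[AC lA]].
  rewrite agree_cons => /andP[ax cy]; rewrite (bigD1 A) ?AC //= ax /=.
  by case/andP: lA cy => + _; rewrite -/k; case: (coord A k) => // a _ /eqP->; rewrite eqxx.
by rewrite exchange_big; apply: leq_sum => A _; apply: sum_pred_Some_le.
Qed.

Lemma clear_not_covered x k : clear covered x -> k < size x ->
  ~~ covered (drop (size x - k) x) (nth 0 (rev x) k).
Proof.
elim: x => //= y x IH /andP[By cx]; rewrite ltnS leq_eqVlt => /predU1P[->|kx].
  by rewrite subSn // subnn drop1 /= rev_cons nth_rcons size_rev ltnn eqxx.
by rewrite subSn ?(ltnW kx) //= rev_cons nth_rcons size_rev kx IH.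
Qed.

Lemma clear_uncovered x : size x = n ->
  all (fun j => nth 0 (rev x) j < side j) (iota 0 n) -> clear covered x ->
  exists z : point n, forall A, A \in C -> ~~ in_hyperplane A z.
Proof.
move=> sx xp cx.
have rng (i : 'I_n) : nth 0 (rev x) i < side i by rewrite (allP xp) // mem_iota ltn_ord.
exists [ffun i => Ordinal (rng i)] => A AC; apply/negP => /forallP Az.
have [k lk] := last_fixed_ex AC; have kx : k < size x by rewrite sx.
have := clear_not_covered cx kx; rewrite /covered; set x' := drop _ x.
have sx' : size x' = k by rewrite size_drop subKn // ltnW.
move=> /existsP[]; exists A; rewrite AC sx' lk /=.
apply/allP => j; rewrite mem_iota /= add0n ltnS => jk.
have jn : j < n by apply: leq_ltn_trans jk _.
have -> : agree_at A (nth 0 (rev x) k :: x') j = agree_at A x j.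
  rewrite /agree_at rev_cons nth_rcons size_rev sx' rev_drop subKn ?(ltnW kx) //.
  have [jk'|jk'|->] := ltngtP j k; by [rewrite nth_take | lia |].
have := Az (Ordinal jn); rewrite ffunE /agree_at -[j]/(nat_of_ord (Ordinal jn)) coordE.
by case: (A (Ordinal jn)) => //= a /eqP/(congr1 val)/= ->.
Qed.

End Hyperplanes.

Theorem no_cover_of_loss (R : realFieldType) n (C : {set hyperplane n}) (t : nat -> nat) :
  (forall k, t k < side k) ->
  (\sum_(k < n) loss R side t k < 1)%R ->
  (forall A, A \in C -> fixed A != set0) ->
  (forall A A', A \in C -> A' \in C -> parallel A A' -> A = A') ->
  exists z : point n, forall A, A \in C -> ~~ in_hyperplane A z.
Proof.
move=> tp lt1 C0 Cinj.
have [x sx [xp cx]] := exists_clear tp (hypsum_covers Cinj side) (covered_le C side) lt1.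
exact: clear_uncovered sx xp cx.
Qed.

(** * Primes and second moments *)

Section Primes.

Lemma next_primeP p :
  [/\ p < next_prime p, prime (next_prime p) &
      forall q, p < q -> prime q -> next_prime p <= q].
Proof.
rewrite /next_prime; case: ex_minnP => q /andP[pq Hq] min_q; split=> // r pr Hr.
by apply: min_q; rewrite pr.
Qed.

Lemma side_prime k : prime (side k).
Proof. by have [] := next_primeP (kth_prime k). Qed.

Lemma side_ltS k : side k < side k.+1.
Proof. by have [] := next_primeP (side k). Qed.

Lemma sideS_le k m : side k < m -> prime m -> side k.+1 <= m.
Proof. by have [_ _] := next_primeP (side k); apply. Qed.

Lemma side0_le m : 2 < m -> prime m -> side 0 <= m.
Proof. by have [_ _] := next_primeP 2; apply. Qed.

Lemma side_gt2 k : 2 < side k.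
Proof.
elim: k => [|k IH]; first by have [] := next_primeP 2.
exact: ltn_trans (side_ltS k).
Qed.

(** A larger threshold reduces the excess but raises [xi], and with it all later expectations. *)
Definition threshold k := (side k + 3) %/ 4.

Lemma threshold_lt k : threshold k < side k.
Proof. by rewrite /threshold; have := side_gt2 k; lia. Qed.

Lemma threshold_gt0 k : 0 < threshold k.
Proof. by rewrite /threshold; have := side_gt2 k; lia. Qed.

Lemma side_le_threshold k : side k <= 4 * threshold k.
Proof. by rewrite /threshold; lia. Qed.

Lemma threshold_compl k : 3 * (side k).-1 <= 4 * (side k - threshold k).
Proof.
have p2 := side_gt2 k; have := even_prime (side_prime k); rewrite /threshold.
by case=> [|odd_p]; lia.
Qed.

End Primes.

Section Moments.
Local Open Scope ring_scope.

Variable R : realFieldType.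

(** AM-GM for [t] and [m - t], whose sum is [m]. *)
Lemma excess_le_square (t m : nat) : (0 < t)%N ->
  ((m - t)%N%:R : R) <= (4 * t)%N%:R^-1 * (m ^ 2)%N%:R.
Proof.
move=> t0; rewrite mulrC ler_pdivlMr ?ltr0n ?muln_gt0 // -natrM ler_nat.
have [mt|/ltnW/subnK <-] := leqP m t; first by rewrite (eqP mt).
by rewrite addnK mulnCA nat_AGM2.
Qed.

Let E k : R := expect side threshold k (fun m => (m ^ 2)%N%:R).

Lemma secondS k : E k.+1 = (1 + 3 * xi R side threshold k) * E k.
Proof.
rewrite /E /=; set x := xi _ _ _ _; set e := expect _ _ _ _.
suff -> : expect side threshold k (fun m => (m.*2 ^ 2)%N%:R) = 4 * e by ring.
apply/eqP; rewrite eq_le; apply/andP; split.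
  by apply: (expect_le threshold_lt) => m; rewrite -(natrM _ 4) -mul2n expnMn.
rewrite -ler_pdivlMl //; apply: (expect_le threshold_lt) => m.
by rewrite ler_pdivlMl // -(natrM _ 4) -mul2n expnMn.
Qed.

Lemma second_ge0 k : 0 <= E k.
Proof. by apply: (expect_ge0 threshold_lt) => m; rewrite ler0n. Qed.

Lemma loss_le_second k (q : R) : 0 < q -> q + 1 <= (side k)%:R ->
  loss R side threshold k <= 4 / 3 * E k / q ^+ 2 /\
  1 + 3 * xi R side threshold k <= 1 + 4 / q.
Proof.
move=> q0 qp; have p2 := side_gt2 k.
have qp1 : q <= (side k).-1%:R.
  by rewrite -subn1 natrB ?lerBrDr //; lia.
have xle : 3 * xi R side threshold k <= 4 / q.
  rewrite ler_pdivlMr // mulrAC ler_pdivrMr ?ltr0n ?subn_gt0 ?threshold_lt //.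
  apply: (@le_trans _ _ (3 * (side k).-1%:R)); first by rewrite ler_wpM2l.
  by rewrite -!natrM ler_nat threshold_compl.
split; last by rewrite lerD2l.
have Ele : expect side threshold k (fun m => (m - threshold k)%N%:R) <=
    (4 * threshold k)%N%:R^-1 * E k.
  by apply: (expect_le threshold_lt) => m; apply/excess_le_square/threshold_gt0.
have le_inv : (4 * threshold k)%N%:R^-1 <= q^-1 :> R.
  rewrite lef_pV2 ?posrE ?ltr0n ?muln_gt0 ?threshold_gt0 //.
  apply: le_trans qp1 _; rewrite ler_nat; have := side_le_threshold k; lia.
have xi0 := xi_ge0 R side threshold k; have E0 := second_ge0 k.
rewrite /loss; apply: (@le_trans _ _ (xi R side threshold k * (q^-1 * E k))).
  by rewrite ler_wpM2l // (le_trans Ele) // ler_wpM2r.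
have -> : 4 / 3 * E k / q ^+ 2 = (4 / q / 3) * (q^-1 * E k).
  by field; rewrite gt_eqF.
by rewrite ler_wpM2r ?mulr_ge0 ?invr_ge0 ?(ltW q0) // ler_pdivlMr // mulrC.
Qed.

(* With [q] the linear lower bound for the sides, a multiple of [E / q]
   dominates all later losses because [E] grows by a factor at most
   [1 + 4 / q] and [q] by more than 4; here [77 / 16 = 2310 / 480]. *)
Lemma tail_loss K (q : R) n : 310 <= q ->
  (forall i, q + 77 / 16 * i%:R + 1 <= (side (K + i))%:R) ->
  \sum_(i < n) loss R side threshold (K + i) +
    5 / 3 * E (K + n) / (q + 77 / 16 * n%:R) <= 5 / 3 * E K / q.
Proof.
move=> q310 qp; elim: n => [|n IH].
  by rewrite big_ord0 add0r addn0 mulr0 addr0.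
apply: le_trans IH; rewrite big_ord_recr /= -addrA lerD2l addnS.
set r := q + 77 / 16 * n%:R.
have r310 : 310 <= r by apply: le_trans q310 _; rewrite lerDl mulr_ge0 ?divr_ge0 ?ler0n.
have r0 : 0 < r by apply: lt_le_trans r310.
have -> : q + 77 / 16 * n.+1%:R = r + 77 / 16 by rewrite /r -natr1; ring.
have [le_loss le_x] := loss_le_second r0 (qp n).
have E0 := second_ge0 (K + n); rewrite secondS.
apply: (@le_trans _ _ (4 / 3 * E (K + n) / r ^+ 2 +
    5 / 3 * ((1 + 4 / r) * E (K + n)) / (r + 77 / 16))).
  rewrite lerD // ler_wpM2r ?invr_ge0 ?ler_wpM2l ?ler_wpM2r //; lra.
(* The slope exceeds [24 / 5]: since [5 * 77 / 16 - 24 = 1 / 16], the difference has numerator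
   [r - 308], which explains the condition [310 <= q]. *)
rewrite -subr_ge0.
have -> : 5 / 3 * E (K + n) / r -
    (4 / 3 * E (K + n) / r ^+ 2 + 5 / 3 * ((1 + 4 / r) * E (K + n)) / (r + 77 / 16)) =
    E (K + n) * ((r - 308) / (48 * r ^+ 2 * (r + 77 / 16))).
  by field; rewrite !gt_eqF //; lra.
rewrite mulr_ge0 // divr_ge0 //; first lra.
by rewrite !mulr_ge0 ?exprn_ge0 //; lra.
Qed.

End Moments.

(** * Residues coprime to 2310, and trial division *)

Section Wheel.

Definition dvdN (d m : N) : bool := N.eqb (N.modulo m d) 0.

Lemma dvdNE d m : dvdN d m = (N.to_nat d %| N.to_nat m).
Proof.
apply/N.eqb_spec/dvdnP; rewrite N.Lcm0.mod_divide.
  case=> q ->; exists (N.to_nat q); lia.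
by case=> q mq; exists (N.of_nat q); lia.
Qed.

Definition wheel (m : N) : bool := all (fun d => ~~ dvdN d m) [:: 2; 3; 5; 7; 11]%num.

Lemma wheel_periodic m : wheel (m + 2310) = wheel m.
Proof.
rewrite /wheel; apply: eq_in_all => d; rewrite !inE.
by rewrite !dvdNE => /or4P[|||/orP[]] /eqP->; congr (~~ _); lia.
Qed.

Lemma prime_wheel p : prime p -> 11 < p -> wheel (N.of_nat p).
Proof.
move=> pr_p p11; apply/allP => d dw; rewrite dvdNE Nnat.Nat2N.id.
have d1 : (N.to_nat d != 1) && (N.to_nat d < p).
  by move: dw; rewrite !inE => /or4P[|||/orP[]] /eqP->; rewrite /= (leq_trans _ p11).
case/andP: d1 => d1 dp; apply: contraL dp => /(prime_nt_dvdP pr_p d1)->.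
by rewrite ltnn.
Qed.

Fixpoint wheel_count (n : nat) (m : N) : nat :=
  if n is n'.+1 then wheel m + wheel_count n' (N.succ m) else 0.

Lemma wheel_countD a b m :
  wheel_count (a + b) m = wheel_count a m + wheel_count b (m + N.of_nat a).
Proof.
elim: a m => [|a IH] m; first by rewrite N.add_0_r.
by rewrite addSn /= IH addnA; congr (_ + wheel_count b _); lia.
Qed.

(* [s] is the current value of [16 * i + s0 - 77 * wheel_count i m0]; the
   check fails as soon as it would become negative. *)
Fixpoint wheel_check (n : nat) (m s : N) : option N :=
  if n is n'.+1 then
    let s' := (s + 16)%num in
    if wheel m then
      if N.leb 77 s' then wheel_check n' (N.succ m) (s' - 77) else None
    else wheel_check n' (N.succ m) s'
  else Some s.

Lemma wheel_checkP n m s s' : wheel_check n m s = Some s' ->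
  77 * wheel_count n m + N.to_nat s' = 16 * n + N.to_nat s /\
  forall i, i <= n -> 77 * wheel_count i m <= 16 * i + N.to_nat s.
Proof.
elim: n m s => [|n IH] m s /=.
  by case=> ->; split=> // -[|i].
case: ifP => wm; last first.
  by move=> /IH[eq_n le_i]; split=> [|[//|i] /le_i]; rewrite /= ?wm; lia.
case: N.leb_spec => // le77 /IH[eq_n le_i].
by split=> [|[//|i] /le_i]; rewrite /= ?wm; lia.
Qed.

(** The credit returns to its initial value because [77 * 480 = 16 * 2310], so the bound repeats in
    every period. The credit [1600 = 16 * 100] absorbs fluctuations and costs 100 in [side_ge],
    where [3901 = 4001 - 100]. *)
Lemma wheel_start : wheel_check 2310 4001 1600 = Some 1600%num.
Proof. by vm_compute. Qed.

Lemma wheel_count_periodic n m : wheel_count n (m + 2310) = wheel_count n m.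
Proof. by elim: n m => //= n IH m; rewrite wheel_periodic -N.add_succ_l IH. Qed.

Lemma wheel_count_le i : 77 * wheel_count i 4001 <= 16 * i + 1600.
Proof.
have [eq_n le_i] := wheel_checkP wheel_start.
elim/ltn_ind: i => i IH; have [i_le|i_gt] := leqP i 2310; first exact: le_i.
have IH' := IH (i - 2310); rewrite -(subnKC (ltnW i_gt)) wheel_countD.
have -> : (4001 + N.of_nat 2310 = 4001 + 2310)%num by [].
rewrite wheel_count_periodic; move: eq_n IH'; clear -i_gt.
set w := wheel_count 2310 _; move: (wheel_count _ _) w => w' w; lia.
Qed.

Lemma side_mono k l : k <= l -> side k <= side l.
Proof.
by move/subnK<-; elim: (l - k) => // i IH; apply: leq_trans IH (ltnW (side_ltS _)).
Qed.

(** The sides with indices from [K] to [K + i - 1] are [i] distinct primes in the counted interval,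
    and primes above 11 pass the wheel. *)
Lemma le_wheel_count P K i : 11 < P -> P <= side K ->
  i <= wheel_count (side (K + i) - P) (N.of_nat P).
Proof.
move=> P11 PK; elim: i => // i IH.
have := side_ltS (K + i); have := leq_trans PK (side_mono (leq_addr i K)).
rewrite addnS; set p := side (K + i) in IH * => Pp lt_p.
have -> : side (K + i).+1 - P = (p - P) + (1 + (side (K + i).+1 - p.+1)) by lia.
rewrite !wheel_countD /=.
have -> : (N.of_nat P + N.of_nat (p - P))%num = N.of_nat p by lia.
have -> : wheel (N.of_nat p) by rewrite prime_wheel ?side_prime ?(leq_trans P11).
by rewrite addn0 addnA addn1 (leq_trans _ (leq_addr _ _)).
Qed.

Lemma side_ge K i : 4001 <= side K -> 16 * 3901 + 77 * i <= 16 * side (K + i).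
Proof.
move=> PK; have := @le_wheel_count 4001 K i isT PK; have := wheel_count_le (side (K + i) - 4001).
rewrite -[4001%num]/(N.of_nat 4001).
have := leq_trans PK (side_mono (leq_addr i K)).
by move: (side _) (wheel_count _ _) => p w; lia.
Qed.

(** The primes below 64, enough for trial division below [64 ^ 2 = 4096]. *)
Definition small_primes : seq N :=
  [:: 2; 3; 5; 7; 11; 13; 17; 19; 23; 29; 31; 37; 41; 43; 47; 53; 59; 61]%num.

Definition primeN (m : N) : bool :=
  all (fun d => ~~ dvdN d m || N.eqb m d) small_primes.

Lemma primeNP m : (2 < m < 4096)%N -> primeN (N.of_nat m) = prime m.
Proof.
move=> /andP[m2 m4096]; apply/allP/idP => [ndiv|pr_m d d_small]; last first.
  rewrite -implybE dvdNE Nnat.Nat2N.id; apply/implyP => dm; apply/N.eqb_spec.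
  have d1 : N.to_nat d != 1%N by move: d_small; rewrite !inE; lia.
  by rewrite -(prime_nt_dvdP pr_m d1 dm) Nnat.N2Nat.id.
apply: contraT => npr; have := ltn_pdiv2_prime (ltnW (ltnW m2)).
move/contraNN/(_ npr); rewrite -leqNgt => le_m.
have m1 : (1 < m)%N by apply: ltnW.
have d64 : (pdiv m < 64)%N by rewrite -(@ltn_sqr _ 64); apply: leq_ltn_trans le_m m4096.
have : all (fun d => prime d ==> (N.of_nat d \in small_primes)) (iota 0 64) by vm_compute.
move/allP/(_ (pdiv m)); rewrite mem_iota d64 pdiv_prime // => /(_ isT)/ndiv.
rewrite dvdNE !Nnat.Nat2N.id pdiv_dvd => /N.eqb_spec/Nnat.Nat2N.inj m_pdiv.
by rewrite m_pdiv pdiv_prime in npr.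
Qed.

End Wheel.

(** * The primes below 4001 *)

(* Upper bounds for [expect k], scaled by [scale]: a list [u] with [u_b]
   bounding the probability of [b] agreements for [b < 10], and [T] bounding
   the contribution of [b >= 10] to the second moment.  The latter gains
   [4 ^ 10 = 1048576] times whatever moves from [b = 9] to [b = 10]. *)
Section Computation.

#[local] Arguments N.add : simpl never.
#[local] Arguments N.mul : simpl never.
#[local] Arguments N.sub : simpl never.

Definition scale : N := 1000000000000.

Definition ceil_div (a d : N) : N := N.succ (a / d).

Fixpoint next_probs (d prev : N) (u : seq N) : seq N :=
  if u is a :: u' then ceil_div ((d - 1) * a + prev) d :: next_probs d a u' else [::].

Fixpoint excess (t w : N) (u : seq N) : N :=
  if u is a :: u' then (a * (w - t) + excess t (2 * w) u')%num else 0%num.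

Fixpoint second (w : N) (u : seq N) : N :=
  if u is a :: u' then (a * w + second (4 * w) u')%num else 0%num.

(** Here [xi = 1 / d]. The tail enters the loss through [m - t <= m ^ 2 / (4 t)] and grows by
    [1 + 3 / d], since an agreement quadruples squares. *)
Definition step (p : N) (st : N * seq N * N) : N * seq N * N :=
  let: (l, u, T) := st in
  let t := ((p + 3) / 4)%num in
  let d := (p - t)%num in
  ((l + ceil_div (4 * t * excess t 1 u + T) (4 * t * d))%num,
   next_probs d 0 u,
   ceil_div ((d + 3) * T + 1048576 * last 0%num u) d).

Fixpoint run (fuel : nat) (m : N) (st : N * seq N * N) : N * seq N * N :=
  if fuel is fuel'.+1 then
    run fuel' (N.succ m) (if primeN m then step m st else st)
  else st.

Definition start : N * seq N * N := (0%num, scale :: nseq 9 0%num, 0%num).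

(* The state after all primes below 4001 loses, together with the bound
   [5 / 3 * E / 3900] of [tail_loss], less than the initial mass. *)
Definition accepted (st : N * seq N * N) : bool :=
  let: (l, u, T) := st in
  N.ltb (3 * 3900 * l + 5 * (second 1 u + T)) (3 * 3900 * scale).

Local Open Scope ring_scope.

Variable R : realFieldType.

Definition ofN (a : N) : R := (N.to_nat a)%:R.

Lemma ofN_ge0 a : 0 <= ofN a. Proof. exact: ler0n. Qed.

Lemma ofND a b : ofN (a + b) = ofN a + ofN b.
Proof. by rewrite /ofN -natrD; congr _%:R; lia. Qed.

Lemma ofNM a b : ofN (a * b) = ofN a * ofN b.
Proof. by rewrite /ofN -natrM; congr _%:R; lia. Qed.

Lemma ofNB a b : (b <= a)%num -> ofN (a - b) = ofN a - ofN b.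
Proof. by move=> ba; rewrite /ofN -natrB; [congr _%:R|]; lia. Qed.

Lemma ofN_gt0 a : (0 < a)%num -> 0 < ofN a.
Proof. by move=> a0; rewrite ltr0n; lia. Qed.

Lemma ceil_div_ge a d : (0 < d)%num -> ofN a / ofN d <= ofN (ceil_div a d).
Proof.
move=> d0; rewrite ler_pdivrMr ?ofN_gt0 // -ofNM ler_nat /ceil_div.
have := N.mul_succ_div_gt a d; lia.
Qed.

Fixpoint eval (u : seq N) (phi : nat -> R) : R :=
  if u is a :: u' then ofN a * phi 1%N + eval u' (fun m => phi m.*2) else 0.

Lemma eq_eval u phi psi : phi =1 psi -> eval u phi = eval u psi.
Proof.
by elim: u phi psi => //= a u IH phi psi e; rewrite e (IH _ (fun m => psi m.*2)).
Qed.

Lemma eval_excess t w u : (0 < w)%num ->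
  eval u (fun m => (N.to_nat w * m - N.to_nat t)%N%:R) = ofN (excess t w u).
Proof.
elim: u w => [|a u IH] w w0 //=; rewrite ofND ofNM; congr (_ * _ + _).
  by rewrite /ofN; congr _%:R; lia.
by rewrite -IH; last lia; apply: eq_eval => m; congr _%:R; lia.
Qed.

Lemma eval_second w u : eval u (fun m => (N.to_nat w * m ^ 2)%N%:R) = ofN (second w u).
Proof.
elim: u w => [|a u IH] w //=; rewrite ofND ofNM; congr (_ * _ + _).
  by rewrite /ofN; congr _%:R; lia.
by rewrite -IH; apply: eq_eval => m; congr _%:R; rewrite -mul2n expnMn; lia.
Qed.

(** An agreement moves each entry one place up. What falls off the end is the last term, which [T]
    absorbs later. *)
Lemma eval_next_probs d prev u phi : (0 < d)%num -> (forall m, 0 <= phi m) ->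
  (1 - (ofN d)^-1) * eval u phi +
    (ofN d)^-1 * (ofN prev * phi 1%N + eval u (fun m => phi m.*2)) <=
  eval (next_probs d prev u) phi +
    (ofN d)^-1 * ofN (last prev u) * phi (2 ^ size u)%N.
Proof.
move=> d0; elim: u prev phi => [|a u IH] prev phi phi0 /=.
  by rewrite mulr0 !add0r addr0 mulrA.
have := IH a (fun m => phi m.*2) (fun m => phi0 _).
have := ceil_div_ge ((d - 1) * a + prev) d0.
have d_neq0 : ofN d != 0 by rewrite gt_eqF ?ofN_gt0.
rewrite ofND ofNM ofNB; last lia.
have -> : (2 ^ (size u).+1 = (2 ^ size u).*2)%N by rewrite expnS mul2n.
move/(ler_wpM2r (phi0 1%N)).
set x := (ofN d)^-1; set c := ofN (ceil_div _ _).
have -> : ((ofN d - ofN 1) * ofN a + ofN prev) * x = (1 - x) * ofN a + x * ofN prev.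
  by rewrite /x -[ofN 1]/(1 : R); field.
move: (eval u (fun m => phi m.*2)) => e1 le1 le2.
move: (lerD le1 le2); rewrite -subr_ge0 => le12; rewrite -subr_ge0.
by apply: le_trans le12 _; rewrite le_eqVlt; apply/orP; left; apply/eqP; ring.
Qed.

#[local] Opaque scale.

Let F k := expect (R := R) side threshold k.

(** Quadratic growth of [phi] is required only from [2 ^ 10] on. This admits both the excess, with
    [c = 1 / (4 t)], and the square, with [c = 1]. *)
Definition dominated k (u : seq N) (T : N) :=
  size u = 10 /\ forall (phi : nat -> R) c, 0 <= c -> (forall m, 0 <= phi m) ->
    (forall m, (2 ^ 10 <= m)%N -> phi m <= c * (m ^ 2)%N%:R) ->
    ofN scale * F k phi <= eval u phi + c * ofN T.

Definition sound k (st : N * seq N * N) :=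
  let: (l, u, T) := st in
  ofN scale * (\sum_(j < k) loss R side threshold j) <= ofN l /\ dominated k u T.

Lemma sound_start : sound 0 start.
Proof.
rewrite /sound /start big_ord0 mulr0 ofN_ge0; split=> //; split=> // phi c _ _ _.
by rewrite /= -[ofN 0]/(0 : R) !mul0r mulr0 !addr0.
Qed.

Lemma top_sq : ((2 ^ 10) ^ 2)%N%:R = ofN 1048576.
Proof.
have top : (2 ^ 10)%N = N.to_nat 1024 by vm_compute.
have -> : 1048576%num = (1024 * 1024)%num by [].
by rewrite top ofNM natrX expr2.
Qed.

Lemma size_next_probs d a u : size (next_probs d a u) = size u.
Proof. by elim: u a => //= b u IH a; rewrite IH. Qed.

Lemma dominated_step k u T t d :
  t = N.of_nat (threshold k) -> d = N.of_nat (side k - threshold k) ->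
  dominated k u T -> dominated k.+1 (next_probs d 0 u)
    (ceil_div ((d + 3) * T + 1048576 * last 0%num u) d).
Proof.
move=> et ed [su domu]; have d0 : (0 < d)%num by have := threshold_lt k; lia.
split=> [|phi c c0 phi0 phic]; first by rewrite size_next_probs.
have xE : xi R side threshold k = (ofN d)^-1 by rewrite /xi /ofN ed Nnat.Nat2N.id.
have x0 := xi_ge0 R side threshold k; have x1 := xi_le1 R threshold_lt k.
have dom1 := domu phi c c0 phi0 phic.
(* Replacing [m] by [2 m] turns the constant [c] into [4 * c]; this gives the factor [d + 3] of
   [T]. *)
have dom2 : ofN scale * F k (fun m => phi m.*2) <=
    eval u (fun m => phi m.*2) + 4 * c * ofN T.
  apply: domu => [|m|m m10]; rewrite ?mulr_ge0 //.
  apply: le_trans (phic _ _) _; first by rewrite -addnn (leq_trans m10) ?leq_addr.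
  by rewrite -mul2n expnMn natrM mulrCA mulrA.
have dom3 := eval_next_probs 0 u d0 phi0.
have lastu : ofN (last 0%num u) * phi (2 ^ size u)%N <=
    ofN (last 0%num u) * (c * ofN 1048576).
  by rewrite ler_wpM2l ?ofN_ge0 // su -top_sq phic.
have := ceil_div_ge ((d + 3) * T + 1048576 * last 0%num u) d0.
rewrite !(ofND, ofNM); move: (ofN (ceil_div _ _)) (ofN 1048576) lastu => cd big lastu.
move: dom3; rewrite -xE -[ofN 3]/(3 : R) -[ofN 0]/(0 : R) mul0r add0r.
have : ofN d * xi R side threshold k = 1 by rewrite xE mulfV // gt_eqF ?ofN_gt0.
rewrite /F /= -/(F k) -/(F k); set x := xi _ _ _ _ in x0 x1 * => dx dom3.
have -> : ((ofN d + 3) * ofN T + big * ofN (last 0%num u)) * x =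
  (ofN d * x + 3 * x) * ofN T + x * (big * ofN (last 0%num u)) by ring.
rewrite dx => /(ler_wpM2l c0) leT.
have {}lastu := ler_wpM2l x0 lastu.
have {}dom1 : (1 - x) * (ofN scale * F k phi) <= (1 - x) * (eval u phi + c * ofN T).
  by rewrite ler_wpM2l // subr_ge0.
have {}dom2 := ler_wpM2l x0 dom2.
move: (F k phi) (F k _) (eval u phi) (eval u _) (eval _ phi) dom1 dom2 dom3 lastu leT.
move: (ofN scale) (ofN T) (ofN (last _ _)) (phi _) => sc T' l f F1 F2 e1 e2 e3.
lra.
Qed.

Lemma loss_step k u T t d :
  t = N.of_nat (threshold k) -> d = N.of_nat (side k - threshold k) ->
  dominated k u T -> ofN scale * loss R side threshold k <=
    ofN (ceil_div (4 * t * excess t 1 u + T) (4 * t * d)).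
Proof.
move=> et ed [su domu]; have t0 := threshold_gt0 k.
have d0 : (0 < d)%num by have := threshold_lt k; lia.
have td0 : (0 < 4 * t * d)%num by apply: N.mul_pos_pos d0; lia.
apply: le_trans (ceil_div_ge _ td0).
have xE : xi R side threshold k = (ofN d)^-1 by rewrite /xi /ofN ed Nnat.Nat2N.id.
have := domu (fun m => (m - threshold k)%N%:R) (4 * threshold k)%N%:R^-1.
rewrite invr_ge0 ler0n => /(_ isT (fun m => ler0n _ _) (fun m _ => excess_le_square _ _ t0)).
have -> : eval u (fun m => (m - threshold k)%N%:R) = ofN (excess t 1 u).
  by rewrite -eval_excess //; apply: eq_eval => m; rewrite et Nnat.Nat2N.id mul1n.
have -> : (4 * threshold k)%N%:R = ofN (4 * t) by congr _%:R; lia.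
rewrite !(ofND, ofNM) /loss xE.
have d_neq0 : ofN d != 0 by rewrite gt_eqF ?ofN_gt0.
have t_neq0 : ofN t != 0 by rewrite gt_eqF ?ofN_gt0 //; lia.
have four_neq0 : ofN 4 != 0 by rewrite gt_eqF ?ofN_gt0.
have dV0 : 0 <= (ofN d)^-1 by rewrite invr_ge0 ofN_ge0.
move/(ler_wpM2l dV0); rewrite mulrCA => /le_trans; apply.
rewrite le_eqVlt; apply/orP; left; apply/eqP; field.
by rewrite d_neq0 t_neq0 four_neq0.
Qed.

Lemma sound_step k st : sound k st -> sound k.+1 (step (N.of_nat (side k)) st).
Proof.
case: st => [[l u] T] [le_l dom] /=.
have et : ((N.of_nat (side k) + 3) / 4)%num = N.of_nat (threshold k).
  by apply/esym/(N.div_unique _ _ _ (N.of_nat ((side k + 3) %% 4))); rewrite /threshold; lia.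
rewrite et -Nnat.Nat2N.inj_sub; split; last exact: dominated_step dom.
rewrite big_ord_recr mulrDr ofND lerD //; exact: loss_step dom.
Qed.

(** Invariant: [side k] is the least prime that is at least [m], so if [m] is prime it is exactly
    the next side to process. *)
Lemma sound_run fuel m k st : sound k st -> (2 < m)%N -> (m + fuel <= 4096)%N ->
  (m <= side k)%N -> (forall q, prime q -> m <= q -> side k <= q)%N ->
  exists2 K, (m + fuel <= side K)%N & sound K (run fuel (N.of_nat m) st).
Proof.
elim: fuel m k st => [|fuel IH] m k st snd m2 mf mk min_k.
  by exists k; rewrite ?addn0.
rewrite [run _ _ _]/= primeNP; last by rewrite m2; lia.
rewrite -Nnat.Nat2N.inj_succ addnS -addSn.
have [m2' mf'] : (2 < m.+1)%N /\ (m.+1 + fuel <= 4096)%N by lia.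
have [pr_m|npr_m] := boolP (prime m).
  have km : m = side k by apply/eqP; rewrite eqn_leq mk min_k.
  have snd' := sound_step snd; rewrite -km in snd'.
  apply: (IH _ _ _ snd' m2' mf') => [|q pr_q mq]; first by rewrite km side_ltS.
  by apply: sideS_le; rewrite // -km.
apply: (IH _ _ _ snd m2' mf') => [|q pr_q /ltnW]; last exact: min_k.
by rewrite ltn_neqAle mk andbT; apply: contraNneq npr_m => ->; apply: side_prime.
Qed.

Lemma run_accepted : accepted (run 3998 3 start).
Proof. by vm_compute. Qed.

Lemma sum_lt1_of_scaled (sc a b e tail S1 S2 : R) :
  0 < sc -> 0 <= tail -> sc * e <= b -> sc * S1 <= a ->
  S2 + tail <= 5 / 3 * e / 3900 -> 3 * 3900 * a + 5 * b < 3 * 3900 * sc ->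
  S1 + S2 < 1.
Proof.
move=> sc0 tail0 le_b le_a le_tail lt_sc; rewrite -(ltr_pM2l sc0) mulr1.
have : sc * S2 <= sc * (5 / 3 * e / 3900) by rewrite ler_pM2l //; lra.
lra.
Qed.

Theorem sum_loss_lt1 n : \sum_(k < n) loss R side threshold k < 1.
Proof.
have [K K4001] : exists2 K, (3 + 3998 <= side K)%N & sound K (run 3998 3 start).
  apply: (@sound_run 3998 3 0 start sound_start) => //; first exact: side_gt2.
  by move=> q pr_q q3; apply: side0_le.
move: run_accepted; case: (run _ _ _) => [[l u] T] acc [le_l [su domu]].
have loss0 k := loss_ge0 R threshold_lt k.
(* [n] may be smaller than [K]; as losses are nonnegative, the sum can be extended past [K]. *)
have le_sum : \sum_(k < n) loss R side threshold k <= \sum_(k < K + n) loss R side threshold k.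
  rewrite addnC big_split_ord /= lerDl sumr_ge0 //.
apply: le_lt_trans le_sum _; rewrite big_split_ord /=.
have le_S : ofN scale * F K (fun m => (m ^ 2)%N%:R) <= ofN (second 1 u + T).
  rewrite ofND -eval_second -[ofN T]mul1r.
  have -> : eval u (fun m => (N.to_nat 1 * m ^ 2)%N%:R) = eval u (fun m => (m ^ 2)%N%:R).
    by apply: eq_eval => m; rewrite mul1n.
  by apply: domu => // m _; rewrite ?mul1r.
have q_side i : 3900 + 77 / 16 * i%:R + 1 <= (side (K + i))%:R :> R.
  have := side_ge i K4001; rewrite -(ler_nat R) natrD !natrM; lra.
have sc0 : 0 < ofN scale by apply: ofN_gt0.
have {}acc : 3 * 3900 * ofN l + 5 * ofN (second 1 u + T) < 3 * 3900 * ofN scale.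
  move: acc => /N.ltb_lt acc; rewrite -[3]/(ofN 3) -[3900]/(ofN 3900) -[5]/(ofN 5).
  by rewrite -!ofNM -ofND ltr_nat; lia.
have tail0 : 0 <= 5 / 3 * F (K + n) (fun m => (m ^ 2)%N%:R) / (3900 + 77 / 16 * n%:R).
  apply: divr_ge0; first by rewrite mulr_ge0 ?second_ge0 ?divr_ge0 ?ler0n.
  have : 0 <= n%:R :> R := ler0n _ _.
  by clear; lra.
have q310 : (310 : R) <= 3900 by lra.
exact: sum_lt1_of_scaled sc0 tail0 le_S le_l (tail_loss n q310 q_side) acc.
Qed.

End Computation.

Theorem theorem1p2 (n : nat) (hn : 1 <= n) (C : {set hyperplane n}) :
  (forall A, A \in C -> fixed A != set0) ->
  (forall x : point n, exists2 A, A \in C & in_hyperplane A x) ->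
  exists A, exists B, [/\ A \in C, B \in C, A != B & parallel A B].
Proof.
move=> C0 cover.
(* A boolean form of the conclusion, which can be decided; its failure makes parallel members of [C]
   equal. *)
pose pairs := [exists A, exists B, [&& A \in C, B \in C, A != B & parallel A B]].
have [/existsP[A /existsP[B /and4P[AC BC AB par]]]|none] := boolP pairs.
  by exists A, B.
have par_inj A B : A \in C -> B \in C -> parallel A B -> A = B.
  move=> AC BC par; apply/eqP; apply: contraNT none => AB.
  by apply/existsP; exists A; apply/existsP; exists B; rewrite AC BC AB.
have [z uncovered] := no_cover_of_loss threshold_lt (sum_loss_lt1 rat n) C0 par_inj.
by have [A hA] := cover z; rewrite (negbTE (uncovered A hA)).
Qed.
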